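(* Let $T\in\mathbb{R}^{n\times n}$ be a banded matrix with $p$ subdiagonals and $q$ superdiagonals ($0\le p,q\le n$). Then $T$ is banded totally positive, i.e. all its nontrivial minors are positive, if and only if all its nontrivial contiguous minors are positive.
   Context: Rows and columns are labelled $1,\dots,n$. A matrix $T\in\mathbb{R}^{n\times n}$ belongs to $B_{p,q}$ (banded with $p$ subdiagonals and $q$ superdiagonals) if $T_{i,j}=0$ whenever $j>i+q$ or $i>j+p$. For increasing sequences $i_1<\dots<i_r$ and $j_1<\dots<j_r$ in $\{1,\dots,n\}$, the associated submatrix has entries $(T_{i_k,j_l})_{k,l=1}^r$ and the associated minor is its determinant. For $T\in B_{p,q}$ the submatrix (and its minor) is called trivial (with respect to $(p,q)$) if there is $k\in\{1,\dots,r\}$ such that $(i_k,j_k)$ lies strictly above the $q$-th superdiagonal ($j_k>i_k+q$) or strictly below the $p$-th subdiagonal ($i_k>j_k+p$); otherwise it is nontrivial. A submatrix or minor is contiguous if its rows are $i,i+1,\dots,i+r-1$ and its columns are $j,j+1,\dots,j+r-1$ for some $i,j,r$. A matrix $T\in B_{p,q}$ is banded totally positive if all its nontrivial minors are positive. *)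

(* Defs.v *)
From mathcomp Require Import all_boot all_order all_algebra.
From mathcomp Require Import reals.

Set Implicit Arguments.
Unset Strict Implicit.
Unset Printing Implicit Defensive.

Import Order.TTheory GRing.Theory Num.Theory.

Local Open Scope ring_scope.

(* Rows and columns are labelled by 'I_n, i.e. 0, ..., n - 1 instead of
   1, ..., n; every condition below only depends on differences of labels. *)

(* Stated additively because subtraction on nat is truncated. *)
Definition off_band (p q i j : nat) : bool :=
  ((i + q < j) || (j + p < i))%N.

Definition banded (R : realType) (n p q : nat) (T : 'M[R]_n) : Prop :=
  forall i j : 'I_n, off_band p q i j -> T i j = 0.

(* The label sequences of a minor of order r are functions 'I_r -> 'I_n.
   Order r = 0 is harmlessly allowed: the 0 x 0 determinant is 1. *)
Definition increasing (r n : nat) (f : 'I_r -> 'I_n) : Prop :=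
  forall k l : 'I_r, (k < l)%N -> (f k < f l)%N.

Definition consecutive (r n : nat) (f : 'I_r -> 'I_n) : Prop :=
  exists i : nat, forall k : 'I_r, f k = (i + k)%N :> nat.

Definition minor (R : realType) (n r : nat) (T : 'M[R]_n)
    (f g : 'I_r -> 'I_n) : R :=
  \det (mxsub f g T).

Definition trivial_minor (p q n r : nat) (f g : 'I_r -> 'I_n) : Prop :=
  exists k : 'I_r, off_band p q (f k) (g k).

Definition nontrivial_minors_positive (R : realType) (n p q : nat)
    (T : 'M[R]_n) : Prop :=
  forall (r : nat) (f g : 'I_r -> 'I_n),
    increasing f -> increasing g -> ~ trivial_minor p q f g ->
    0 < minor T f g.

Definition nontrivial_contiguous_minors_positive (R : realType) (n p q : nat)
    (T : 'M[R]_n) : Prop :=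
  forall (r : nat) (f g : 'I_r -> 'I_n),
    consecutive f -> consecutive g -> ~ trivial_minor p q f g ->
    0 < minor T f g.

Definition banded_totally_positive (R : realType) (n p q : nat)
    (T : 'M[R]_n) : Prop :=
  banded p q T /\ nontrivial_minors_positive p q T.

(* Main.v *)
Require Import Defs.
From mathcomp Require Import all_boot all_order all_algebra.
From mathcomp Require Import reals.
From mathcomp Require Import zify ring.

Set Implicit Arguments.
Unset Strict Implicit.
Unset Printing Implicit Defensive.

Import Order.TTheory GRing.Theory Num.Theory.

Local Open Scope ring_scope.

(* Induct on the order r of the minor, then on (a_r - a_1) + (b_r - b_1) for
   its rows a_1 < ... < a_r and columns b_1 < ... < b_r.  If b_{l+1} > a_l + q
   or a_{l+1} > b_l + p for some l, the band condition makes the submatrix block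
   triangular, and the minor is a product of two nontrivial minors of smaller
   order.  Otherwise, if the columns skip an index k, with b_1 < k < b_r, the
   three-term Pluecker relation for the rows a, those rows without a_r, and the
   columns b together with k expresses the product of the minor by a minor of
   order r - 1 as a sum of two products of minors of order r - 1 and r.  The
   inequalities b_{l+1} <= a_l + q and a_{l+1} <= b_l + p make all the other
   minors nontrivial, and those of order r have a smaller column spread, so
   they are all positive.  A gap in the rows is handled by transposition. *)

(* Indexing entries, rows and columns by nat lets insertions, deletions and
   shifts of index sequences be plain functions; only the values of the row and
   column sequences below r matter. *)
Definition nminor (R : comPzRingType) (t : nat -> nat -> R) (r : nat)
    (F G : nat -> nat) : R :=
  \det (\matrix_(i < r, j < r) t (F i) (G j)).

(** * Determinant identities *)

Lemma eq_nminor (R : comPzRingType) (t : nat -> nat -> R) r F F' G G' :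
  (forall k, (k < r)%N -> F k = F' k) -> (forall k, (k < r)%N -> G k = G' k) ->
  nminor t r F G = nminor t r F' G'.
Proof.
move=> eqF eqG; congr (\det _); apply/matrixP => i j.
by rewrite !mxE eqF ?eqG.
Qed.

Lemma nminor_tr (R : comPzRingType) (t : nat -> nat -> R) r F G :
  nminor (fun i j => t j i) r G F = nminor t r F G.
Proof.
by rewrite /nminor -det_tr; congr (\det _); apply/matrixP => i j; rewrite !mxE.
Qed.

Lemma nminor_repeated_row (R : comPzRingType) (t : nat -> nat -> R) r F G i j :
  (i < j < r)%N -> F i = F j -> nminor t r F G = 0.
Proof.
move=> /andP[ij jr] eqF; have ir := ltn_trans ij jr.
apply: (@determinant_alternate _ _ _ (Ordinal ir) (Ordinal jr)).
  by rewrite -val_eqE /= neq_ltn ij.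
by move=> k; rewrite !mxE /= eqF.
Qed.

Lemma nminor_repeated_col (R : comPzRingType) (t : nat -> nat -> R) r F G i j :
  (i < j < r)%N -> G i = G j -> nminor t r F G = 0.
Proof. by rewrite -nminor_tr; apply: nminor_repeated_row. Qed.

Lemma nminor_expand_row (R : comPzRingType) (t : nat -> nat -> R) r F G i :
  (i <= r)%N ->
  nminor t r.+1 F G = (-1) ^+ i *
    \sum_(j < r.+1) (-1) ^+ j * t (F i) (G j) *
      nminor t r (F \o bump i) (G \o bump j).
Proof.
rewrite -ltnS => ir; rewrite /nminor (expand_det_row _ (Ordinal ir)) mulr_sumr.
apply: eq_bigr => j _; rewrite mxE /cofactor exprD !mulrA /=.
rewrite -!mulrA mulrCA; congr (_ * _); rewrite mulrCA; congr (_ * (_ * _)).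
by congr (\det _); apply/matrixP => k l; rewrite !mxE.
Qed.

Lemma nminor_expand_col (R : comPzRingType) (t : nat -> nat -> R) r F G j :
  (j <= r)%N ->
  nminor t r.+1 F G = (-1) ^+ j *
    \sum_(i < r.+1) (-1) ^+ i * t (F i) (G j) *
      nminor t r (F \o bump i) (G \o bump j).
Proof.
move=> jr; rewrite -nminor_tr (nminor_expand_row _ _ _ jr).
by congr (_ * _); apply: eq_bigr => i _; rewrite nminor_tr.
Qed.

Lemma nminor_lblock (R : comPzRingType) (t : nat -> nat -> R) a b F G :
  (forall i j, (i < a)%N -> (a <= j < a + b)%N -> t (F i) (G j) = 0) ->
  nminor t (a + b) F G =
    nminor t a F G * nminor t b (F \o addn a) (G \o addn a).
Proof.
move=> t0; rewrite /nminor -[X in \det X = _]submxK [ursubmx _](_ : _ = 0).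
  by rewrite det_lblock; congr (_ * _); congr (\det _);
     apply/matrixP => i j; rewrite !mxE.
by apply/matrixP => i j; rewrite !mxE /= t0 // leq_addr ltn_add2l ltn_ord.
Qed.

(* The three-term Pluecker relation, for s + 3 columns h of which 0, m and
   s + 2 are exchanged. *)
Lemma nminor_plucker (R : comPzRingType) (t : nat -> nat -> R) s F h m :
  (0 < m < s.+2)%N ->
  nminor t s.+1 F (h \o succn) * nminor t s.+2 F (h \o bump m) =
  nminor t s.+1 F (h \o bump m) * nminor t s.+2 F (h \o succn) +
  nminor t s.+1 F (h \o bump m \o succn) * nminor t s.+2 F h.
Proof.
move=> /andP[m0 ms]; pose w := h \o bump m \o succn.
(* Up to sign, [phi c] is the minor on the rows F 0, ..., F s and the columns
   w and c.  It is linear in the column c and vanishes on w, so applying it to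
   the Cramer relation between the s + 3 columns h of length s + 2 leaves
   three terms. *)
pose phi c := \sum_(i < s.+1) (-1) ^+ i * t (F i) c * nminor t s (F \o bump i) w.
(* Expansion along column [i] of [G], which is [w] with [G i] inserted at position [i]; the sign is
   that of the expansion. *)
have phiE G i : (i <= s)%N -> (forall k, (k < s)%N -> G (bump i k) = w k) ->
    phi (G i) = (-1) ^+ i * nminor t s.+1 F G.
  move=> ilts Gw; rewrite (nminor_expand_col _ _ _ ilts) mulrA -exprD addnn -mul2n.
  rewrite exprM sqrrN expr1n expr1n mul1r; apply: eq_bigr => k _.
  by congr (_ * _); apply: eq_nminor => // l ls; rewrite /= Gw.
have phi0 l : (l < s)%N -> phi (w l) = 0.
  move=> ls; pose G k := if k is k'.+1 then w k' else w l.
  rewrite (@phiE G 0%N) // expr0 mul1r.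
  by apply: (@nminor_repeated_col _ _ _ _ _ 0 l.+1).
have cramer : \sum_(j < s.+3) (-1) ^+ j * phi (h j) * nminor t s.+2 F (h \o bump j) = 0.
  under eq_bigr => j _ do rewrite [X in X * _]mulr_sumr mulr_suml.
  rewrite exchange_big big1 // => i _ /=.
  (* Row [F i] is repeated on top of [F], so the determinant vanishes; its expansion along the top
     row is the Cramer relation for that row. *)
  pose F' k := if k is k'.+1 then F k' else F i.
  have /eqP : nminor t s.+3 F' h = 0.
    apply: (@nminor_repeated_row _ _ _ _ _ 0 i.+1) => //=.
    by have := ltn_ord i; lia.
  rewrite (@nminor_expand_row _ _ _ _ _ 0) // expr0 mul1r => /eqP H.
  transitivity ((-1) ^+ i * nminor t s (F \o bump i) w *
     \sum_(j < s.+3) (-1) ^+ j * t (F' 0%N) (h j) *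
           nminor t s.+2 (F' \o bump 0) (h \o bump j)); last by rewrite H mulr0.
  rewrite mulr_sumr; apply: eq_bigr => j _.
  rewrite (@eq_nminor _ t s.+2 (F' \o bump 0) F (h \o bump j) (h \o bump j)) //.
  rewrite /F'; ring.
move: cramer; rewrite big_ord_recl big_ord_recr /=.
have m1s : (m.-1 < s.+1)%N by lia.
rewrite (bigD1 (Ordinal m1s)) //= big1 ?addr0; last first.
  (* A column other than [0], [m] and [s.+2] belongs to [w]: at the same index [j] to the left of
     [m], shifted by one to the right of it. *)
  move=> j; rewrite -val_eqE /= => jm.
  suff -> : phi (h (bump 0 j)) = 0 by rewrite mulr0 mul0r.
  have := ltn_ord j => js.
  case: (ltngtP j m.-1) => jm'; last by rewrite jm' eqxx in jm.
    rewrite (_ : h _ = w j) ?phi0 //; first lia.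
    by rewrite /w /= /bump; congr h; lia.
  rewrite (_ : h _ = w j.-1) ?phi0 //; first lia.
  by rewrite /w /= /bump; congr h; lia.
have b0 k : bump 0 k = k.+1 by [].
rewrite !b0 (prednK m0).
(* The columns [0], [m], [s.+2] of [h] fit into [w] in increasing order at positions [0], [m.-1],
   [s]. *)
have -> : phi (h 0%N) = nminor t s.+1 F (h \o bump m).
  rewrite -(_ : (h \o bump m) 0%N = h 0%N); last by rewrite /= /bump; congr h; lia.
  by rewrite phiE // expr0 mul1r.
have -> : phi (h m) = (-1) ^+ m.-1 * nminor t s.+1 F (h \o succn).
  rewrite -(phiE _ m.-1) /= ?(prednK m0) //.
  by move=> k ks; rewrite /w /= /bump; congr h; lia.
have -> : phi (h s.+2) = (-1) ^+ s * nminor t s.+1 F w.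
  rewrite -(phiE _ s) //; last first.
    by move=> k ks; rewrite /w /= /bump; congr h; lia.
  by rewrite /w /= /bump; congr (phi (h _)); lia.
rewrite -[in (-1) ^+ m](prednK m0) !exprS expr0 !mul1r.
rewrite (@eq_nminor _ t s.+2 F F (h \o bump 0) (h \o succn)) //.
rewrite (@eq_nminor _ t s.+2 F F (h \o bump s.+2) h) //; last first.
  by move=> k ks; rewrite /= /bump; congr h; lia.
rewrite -!/w -!(signr_odd _ m.-1) -!(signr_odd _ s) => H.
apply/eqP; rewrite eq_sym -subr_eq0 -H; apply/eqP.
by case: (odd m.-1); case: (odd s); rewrite ?expr0 ?expr1; ring.
Qed.

(** * Index sequences and the band condition *)

Definition label_seq (n r : nat) (F : nat -> nat) : Prop :=
  (forall k l, (k < l < r)%N -> (F k < F l)%N) /\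
  (forall k, (k < r)%N -> (F k < n)%N).

Definition in_band (p q r : nat) (F G : nat -> nat) : Prop :=
  forall k, (k < r)%N -> ~~ off_band p q (F k) (G k).

Lemma in_bandC p q r F G : in_band p q r F G -> in_band q p r G F.
Proof. by move=> FG k /FG; rewrite /off_band orbC. Qed.

Definition nbanded (R : comPzRingType) (n p q : nat) (t : nat -> nat -> R) :=
  forall i j, (i < n)%N -> (j < n)%N -> off_band p q i j -> t i j = 0.

Lemma nbanded_tr (R : comPzRingType) n p q (t : nat -> nat -> R) :
  nbanded n p q t -> nbanded n q p (fun i j => t j i).
Proof. by move=> tB i j ni nj; rewrite /off_band orbC; apply: tB. Qed.

Lemma label_seq_leq n r F k l :
  label_seq n r F -> (k <= l < r)%N -> (F k <= F l)%N.
Proof.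
move=> [Fi _] /andP[]; rewrite leq_eqVlt => /orP[/eqP -> //|kl] lr.
by apply/ltnW/Fi; rewrite kl.
Qed.

Lemma label_seq_take n r s F : (s <= r)%N -> label_seq n r F -> label_seq n s F.
Proof. by move=> sr [Fi Fn]; split=> [k l|k] H; [apply: Fi|apply: Fn]; lia. Qed.

Lemma label_seq_drop n r a F : label_seq n (a + r) F -> label_seq n r (F \o addn a).
Proof. by move=> [Fi Fn]; split=> [k l|k] H; [apply: Fi|apply: Fn]; lia. Qed.

Lemma label_seq_gap n r F : label_seq n r.+1 F ->
  (forall k, (k <= r)%N -> F k = (F 0 + k)%N) \/
  exists2 m, (m < r)%N & ((F m).+1 < F m.+1)%N.
Proof.
move=> [Fi _]; elim: r Fi => [|r IHr] Fi; first by left=> k; case: k => //; lia.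
case: IHr => [k l kl|Fc|[m mr gap]]; first by apply: Fi; lia.
  have := Fi r r.+1; rewrite !ltnSn => /(_ isT) lt_r.
  case: (ltnP (F r).+1 (F r.+1)) => gap; first by right; exists r.
  left=> k; rewrite leq_eqVlt => /orP[/eqP ->|]; last exact: Fc.
  by have := Fc r (leqnn r); lia.
by right; exists m => //; lia.
Qed.

(** * Positivity of nontrivial minors *)

Lemma nminor_split_gt0 (R : numDomainType) n p q (t : nat -> nat -> R) a b F G :
  nbanded n p q t ->
  (forall r' F' G', (r' < a.+1 + b.+1)%N -> label_seq n r' F' ->
    label_seq n r' G' -> in_band p q r' F' G' -> 0 < nminor t r' F' G') ->
  label_seq n (a.+1 + b.+1) F -> label_seq n (a.+1 + b.+1) G ->
  in_band p q (a.+1 + b.+1) F G ->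
  (F a + q < G a.+1)%N -> 0 < nminor t (a.+1 + b.+1) F G.
Proof.
move=> tB IH Fl Gl FG cut; rewrite nminor_lblock; last first.
  move=> i j ia jab; apply: tB; [apply: Fl.2|apply: Gl.2|]; try lia.
  (* [F i + q <= F a + q < G a.+1 <= G j]. *)
  rewrite /off_band; apply/orP; left.
  have := @label_seq_leq _ _ _ i a Fl; have := @label_seq_leq _ _ _ a.+1 j Gl; lia.
apply: mulr_gt0; apply: IH; try lia.
- by apply: label_seq_take Fl; lia.
- by apply: label_seq_take Gl; lia.
- by move=> k ka; apply: FG; lia.
- exact: label_seq_drop.
- exact: label_seq_drop.
- by move=> k ka; apply: FG; lia.
Qed.

(** The Pluecker relation exchanges columns only, so the hypothesis on minors of the same order can
    keep the rows [F] fixed and compare column spreads alone. *)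
Lemma nminor_col_gap_gt0 (R : realDomainType) n p q (t : nat -> nat -> R) r F G m :
  nbanded n p q t ->
  (forall r' F' G', (r' < r.+1)%N -> label_seq n r' F' ->
    label_seq n r' G' -> in_band p q r' F' G' -> 0 < nminor t r' F' G') ->
  (forall G', label_seq n r.+1 G' -> in_band p q r.+1 F G' ->
    (G' r - G' 0 < G r - G 0)%N -> 0 < nminor t r.+1 F G') ->
  label_seq n r.+1 F -> label_seq n r.+1 G -> in_band p q r.+1 F G ->
  (m < r)%N -> ((G m).+1 < G m.+1)%N -> 0 < nminor t r.+1 F G.
Proof.
case: r => [//|s] tB IHr IHd Fl Gl FG mr gap.
case: (pickP (fun l : 'I_s.+1 => F l + q < G l.+1)%N) => [l cut|/= ncut].
  have := ltn_ord l; rewrite ltnS => ls.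
  have es : (s.+2 = l.+1 + (s - l).+1)%N by lia.
  by rewrite es in IHr Fl Gl FG *; apply: (nminor_split_gt0 tB IHr Fl Gl FG cut).
case: (pickP (fun l : 'I_s.+1 => G l + p < F l.+1)%N) => [l cut|/= ncut'].
  have := ltn_ord l; rewrite ltnS => ls.
  have es : (s.+2 = l.+1 + (s - l).+1)%N by lia.
  rewrite es in IHr Fl Gl FG *; rewrite -nminor_tr.
  apply: (nminor_split_gt0 (nbanded_tr tB) _ Gl Fl (in_bandC FG) cut).
  move=> r' F' G' rr F'l G'l /in_bandC FG'; rewrite nminor_tr; exact: IHr.
have bq l : (l < s.+1)%N -> (G l.+1 <= F l + q)%N.
  by move=> ls; have := ncut (Ordinal ls) => /=; lia.
have bp l : (l < s.+1)%N -> (F l.+1 <= G l + p)%N.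
  by move=> ls; have := ncut' (Ordinal ls) => /=; lia.
have bqp l : (l < s.+2)%N -> (G l <= F l + q /\ F l <= G l + p)%N.
  by move=> /FG; rewrite /off_band; lia.
have Gs l : (l < s.+1)%N -> (G l < G l.+1)%N by move=> ls; apply: Gl.1; lia.
(* [h] is [G] with the skipped label [(G m).+1] inserted at position [m.+1]. It interlaces with [G]:
   [h k <= G k <= h k.+1]. *)
pose h k := if (k <= m)%N then G k else if k == m.+1 then (G m).+1 else G k.-1.
have h_le k : (k <= m)%N -> h k = G k by rewrite /h => ->.
have h_eq : h m.+1 = (G m).+1 by rewrite /h ltnn eqxx.
have h_gt k : (m.+1 < k)%N -> h k = G k.-1 by move=> mk; rewrite /h !ifF //; lia.
have hG k : (h \o bump m.+1) k = G k.
  rewrite /= /bump; case: (leqP m.+1 k) => mk; first by rewrite h_gt.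
  by rewrite h_le.
have h_lo k : (k <= s.+1)%N -> (h k <= G k)%N.
  move=> ks; case: (ltngtP k m.+1) => km; last by rewrite km h_eq ltnW.
    by rewrite h_le.
  by rewrite h_gt //; have := Gs k.-1; rewrite prednK; lia.
have h_hi k : (k <= s.+1)%N -> (G k <= h k.+1)%N.
  move=> ks; case: (ltngtP k m) => km; last by rewrite km h_eq.
    by rewrite h_le //; apply/ltnW/Gs; lia.
  by rewrite h_gt.
have hl : label_seq n s.+3 h.
  have hS k : (k < s.+2)%N -> (h k < h k.+1)%N.
    move=> ks; case: (ltngtP k m) => km; last by rewrite km h_eq h_le.
      by rewrite !h_le //; [apply: Gs; lia | exact: ltnW].
    rewrite (h_gt k.+1) //=; case: (eqVneq k m.+1) => [->|km']; first by rewrite h_eq.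
    have mk : (m.+1 < k)%N by lia.
    by rewrite h_gt //= -[k in ltnRHS](ltn_predK mk); apply: Gs; lia.
  split.
    move=> k l; elim: l => [|l IHl] kl; first lia.
    have := hS l; case: (ltngtP k l) => kl' //; try lia.
    by rewrite kl'; apply; lia.
  move=> k ks; apply: (@leq_ltn_trans (G s.+1)); last exact: Gl.2.
  case: (ltngtP k s.+2) => ks'; [|lia|by rewrite ks' h_gt].
  by apply: leq_trans (h_lo k _) (label_seq_leq Gl _); lia.
have hlS : label_seq n s.+2 (h \o succn) by apply: (@label_seq_drop _ _ 1).
have GlS : label_seq n s.+1 (G \o succn) by apply: (@label_seq_drop _ _ 1).
have ms : (0 < m.+1 < s.+2)%N by lia.
have hGS k : (h \o bump m.+1 \o succn) k = G k.+1 by rewrite -hG.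
have := nminor_plucker t F h ms.
rewrite (@eq_nminor _ t s.+2 F F _ G) // (@eq_nminor _ t s.+1 F F (_ \o bump _) G) //.
rewrite (@eq_nminor _ t s.+1 F F (_ \o _ \o _) (G \o succn)) //.
have Fl' : label_seq n s.+1 F by apply: label_seq_take Fl.
have hs0 : h 0%N = G 0%N by rewrite h_le.
have hsl : h s.+2 = G s.+1 by rewrite h_gt //; lia.
have h1 : (G 0 < h 1)%N by rewrite -hs0; apply: hl.1.
have hs1 : (h s.+1 < G s.+1)%N by rewrite -hsl; apply: hl.1; lia.
have G0s : (G 0 < G s.+1)%N by apply: Gl.1; lia.
have p1 : 0 < nminor t s.+1 F (h \o succn).
  apply: IHr => //; first exact: label_seq_take hlS.
  (* [h k.+1 <= G k.+1 <= F k + q] and [F k <= G k + p <= h k.+1 + p]. *)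
  move=> k ks; rewrite /off_band /=.
  have := bq k; have := bqp k; have := h_lo k.+1; have := h_hi k; lia.
have p2 : 0 < nminor t s.+1 F G.
  by apply: IHr => //; [exact: label_seq_take Gl | move=> k ks; apply: FG; lia].
have p3 : 0 < nminor t s.+2 F (h \o succn).
  apply: IHd => //; last by rewrite /= hsl; lia.
  move=> k ks; rewrite /off_band /=.
  (* [bq] stops before the last index, but there [h] and [G] share their last label. *)
  case: (eqVneq k s.+1) => [->|ks']; first by rewrite hsl; have := bqp s.+1; lia.
  have := bq k; have := bqp k; have := h_lo k.+1; have := h_hi k; lia.
have p4 : 0 < nminor t s.+1 F (G \o succn).
  apply: IHr => // k ks; rewrite /off_band /=.
  have := bq k; have := bqp k; have := Gs k; lia.
have p5 : 0 < nminor t s.+2 F h.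
  apply: IHd => //; first exact: label_seq_take hl.
    move=> k ks; rewrite /off_band /=; case: k ks => [|k] ks.
      by rewrite hs0; have := bqp 0%N; lia.
    (* The lower side needs [bp], since [h k.+1] may be as small as [G k]. *)
    have := bp k; have := bqp k.+1; have := h_lo k.+1; have := h_hi k; lia.
  by rewrite hs0; lia.
move=> E; rewrite -(pmulr_rgt0 _ p1) E.
by apply: addr_gt0; apply: mulr_gt0.
Qed.

Lemma nminor_gt0 (R : realDomainType) n p q (t : nat -> nat -> R) :
  nbanded n p q t ->
  (forall r a b, (a + r <= n)%N -> (b + r <= n)%N ->
    in_band p q r (addn a) (addn b) -> 0 < nminor t r (addn a) (addn b)) ->
  forall r F G, label_seq n r F -> label_seq n r G -> in_band p q r F G ->
    0 < nminor t r F G.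
Proof.
move=> tB cont; elim/ltn_ind => -[|r] IHr F G; first by rewrite /nminor det_mx00.
have [d] := ubnP (F r - F 0 + (G r - G 0))%N.
elim: d F G => // d IHd F G leFG Fl Gl FG.
case: (label_seq_gap Gl) => [Gc|[m mr gap]]; last first.
  apply: (nminor_col_gap_gt0 tB _ _ Fl Gl FG mr gap).
    by move=> r' F' G' ?; apply: IHr.
  by move=> G' G'l FG' lt; apply: IHd => //; lia.
case: (label_seq_gap Fl) => [Fc|[m mr gap]]; last first.
  rewrite -nminor_tr.
  apply: (nminor_col_gap_gt0 (nbanded_tr tB) _ _ Gl Fl (in_bandC FG) mr gap).
    by move=> r' F' G' ? F'l G'l /in_bandC FG'; rewrite nminor_tr; apply: IHr.
  by move=> F' F'l /in_bandC FG' lt; rewrite nminor_tr; apply: IHd => //; lia.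
rewrite (@eq_nminor _ t _ F (addn (F 0%N)) G (addn (G 0%N))) //.
apply: cont.
- by rewrite addnS -Fc // Fl.2.
- by rewrite addnS -Gc // Gl.2.
- by move=> k kr; rewrite -Fc // -Gc //; apply: FG.
Qed.

(** * Transfer to matrices *)

Lemma consecutive_increasing r n (f : 'I_r -> 'I_n) : consecutive f -> increasing f.
Proof. by move=> [i fE] k l kl; rewrite !fE ltn_add2l. Qed.

Theorem theorem2p9 (R : realType) (n p q : nat) (hp : (p <= n)%N)
    (hq : (q <= n)%N) (T : 'M[R]_n) (hT : banded p q T) :
  banded_totally_positive p q T <-> nontrivial_contiguous_minors_positive p q T.
Proof.
split=> [[_ Tpos] r f g /consecutive_increasing fi /consecutive_increasing gi|Tc].
  exact: Tpos.
split=> // -[|r] f g fi gi fg; first by rewrite /minor det_mx00.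
case: n hp hq T hT Tc f g fi gi fg => [|n] _ _ T hT Tc f g fi gi fg.
  by case: (f ord0).
(* [inord] sends labels outside the matrix to [0]; such entries of [t] never enter, as label
   sequences stay below the size. *)
pose t i j : R := T (inord i) (inord j).
have -> : minor T f g =
    nminor t r.+1 (fun k => f (inord k)) (fun k => g (inord k)).
  congr (\det _); apply/matrixP => i j.
  by rewrite !mxE /t !inord_val.
have lab (e : 'I_r.+1 -> 'I_n.+1) :
    increasing e -> label_seq n.+1 r.+1 (fun k => e (inord k)).
  move=> ei; split=> [k l /andP[kl lr]|k kr]; last exact: ltn_ord.
  by apply: ei; rewrite !inordK //; lia.
apply: (@nminor_gt0 _ n.+1 p q); [|..| exact: lab | exact: lab |].
- by move=> i j ni nj off; apply: hT; rewrite !inordK.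
- move=> s a b an bn ab.
  have ca c : (c + s <= n.+1)%N -> consecutive (fun k : 'I_s => inord (c + k) : 'I_n.+1).
    by move=> cn; exists c => k; rewrite inordK //; have := ltn_ord k; lia.
  suff -> : nminor t s (addn a) (addn b) =
      minor T (fun k : 'I_s => inord (a + k)) (fun k : 'I_s => inord (b + k)).
    apply: Tc; [exact: ca|exact: ca|].
    case=> k; have ks := ltn_ord k; rewrite !inordK; try lia.
    by apply/negP/ab.
  by congr (\det _); apply/matrixP => i j; rewrite !mxE.
- by move=> k kr; apply/negP => off; apply: fg; exists (inord k).
Qed.
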